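(* Let $G$ be a countable monoid. Let $A$ be an admissible Artinian group structure and let $\Sigma\subset A^G$ be a closed admissible group subshift. Let $\Delta \subset A^G$ be a subshift such that $\Delta \subset \Sigma$. Suppose that $\tau \colon \Sigma \to A^G$ is an injective admissible group cellular automaton. Then the following hold: (i) $\Delta$ is a subshift of finite type if and only if so is $\tau(\Delta)$; (ii) $\Delta$ is a sofic subshift if and only if so is $\tau(\Delta)$.
   Context: Symbolic dynamics. Let $G$ be a monoid and $A$ a set. $G$ acts on $A^G$ by $(g\star x)(h)=x(hg)$. A subshift of $A^G$ is a $G$-invariant subset ($g\star x\in\Sigma$ for all $g\in G$, $x\in\Sigma$), not required to be closed. $A^G$ carries the prodiscrete topology (product of discrete topologies), and ''closed'' refers to it. For $E\subset G$, $\Sigma_E=\{x|_E : x\in\Sigma\}\subset A^E$. A subshift of finite type of $A^G$ is a set of the form $\Sigma(A^G;D,P)=\{x\in A^G : (g\star x)|_D\in P \text{ for all } g\in G\}$ with $D\subset G$ finite and $P\subset A^D$. For sets $A,B$ and a subshift $\Sigma\subset A^G$, a map $\tau\colon\Sigma\to B^G$ is a cellular automaton if there are a finite $M\subset G$ (memory set) and a map $\mu\colon\Sigma_M\to B$ (local defining map) with $\tau(x)(g)=\mu((g\star x)|_M)$ for all $x\in\Sigma$, $g\in G$. A subshift is sofic if it is the image of a subshift of finite type (of $C^G$ for some alphabet set $C$) under a cellular automaton. Admissible Artinian group structures. Let $A$ be a group and for every $n\ge 1$ let $\mathcal{H}_n$ be a collection of subgroups of $A^n$ such that: (1) $\{1_A\},A\in\mathcal{H}_1$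 and the diagonal $\{(a,a):a\in A\}\in\mathcal{H}_2$; (2) for $m\ge n\ge 1$ and every projection $\pi\colon A^m\to A^n$ induced by an injection $\{1,\dots,n\}\to\{1,\dots,m\}$, one has $\pi(H_m)\in\mathcal{H}_n$ and $\pi^{-1}(H_n)\in\mathcal{H}_m$ for all $H_m\in\mathcal{H}_m$, $H_n\in\mathcal{H}_n$; (3) for all $n\ge1$ and $H,K\in\mathcal{H}_n$, $H\cap K\in\mathcal{H}_n$; (4) for all $n\ge1$, every descending sequence $(H_k)_{k\ge0}$ of elements of $\mathcal{H}_n$ eventually stabilizes. Then $(A,(\mathcal{H}_n)_{n\ge1})$, or simply $A$, is called an admissible Artinian group structure, and elements of $\mathcal{H}_n$ are called admissible subgroups of $A^n$. For a finite set $E$, admissible subgroups of $A^E$ are defined via an arbitrary bijection $\{1,\dots,|E|\}\to E$. If $X\subset A^m$ and $Y\subset A^n$ are admissible subgroups, a group homomorphism $\varphi\colon X\to Y$ is admissible if its graph $\{(x,\varphi(x)):x\in X\}$ is an admissible subgroup of $A^{m+n}$. A subshift $\Sigma\subset A^G$ is an admissible group subshift if $\Sigma_E$ is an admissible subgroup of $A^E$ for every finite $E\subset G$. For an admissible group subshift $\Sigma\subset A^G$, a map $\tau\colon\Sigma\to A^G$ is an admissible group cellular automaton if it is a cellular automaton admitting a finite memory set $M\subset G$ and an associated local defining map $\mu\colon\Sigma_M\to A$ that is an admissible homomorphism. *)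

(* Defs.v *)
From HB Require Import structures.
From mathcomp Require Import all_boot finmap.
From mathcomp Require Import boolp classical_sets functions cardinality.
From mathcomp Require Import topology_structure discrete_topology.
From mathcomp Require Import function_spaces.

Set Implicit Arguments.
Unset Strict Implicit.
Unset Printing Implicit Defensive.

Local Open Scope classical_set_scope.
Local Open Scope group_scope.

(* The power A^I of a group A is the type I -> A with pointwise operations. *)
Section FunGroup.
Variables (I : Type) (A : groupType).
Implicit Types x y z : I -> A.

Let fmul x y : I -> A := fun i => x i * y i.
Let fone : I -> A := fun=> 1.
Let finv x : I -> A := fun i => (x i)^-1.

Fact fun_mulgA : associative fmul.
Proof. by move=> x y z; apply/funext => i; apply: mulgA. Qed.
Fact fun_mul1g : left_id fone fmul.
Proof. by move=> x; apply/funext => i; apply: mul1g. Qed.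
Fact fun_mulg1 : right_id fone fmul.
Proof. by move=> x; apply/funext => i; apply: mulg1. Qed.
Fact fun_mulVg : left_inverse fone finv fmul.
Proof. by move=> x; apply/funext => i; apply: mulVg. Qed.
Fact fun_mulgV : right_inverse fone finv fmul.
Proof. by move=> x; apply/funext => i; apply: mulgV. Qed.

HB.instance Definition _ := isGroup.Build (I -> A)
  fun_mulgA fun_mul1g fun_mulg1 fun_mulVg fun_mulgV.
End FunGroup.

Definition is_subgroup (T : groupType) (X : set T) : Prop :=
  [/\ X 1, forall x y, X x -> X y -> X (x * y) & forall x, X x -> X x^-1].

(* Only the collections H_n with n >= 1 carry meaning; adm_sub 0 is a dummy
   that nothing below depends on. *)
Record artinian_structure (A : groupType) := ArtinianStructure {
  adm_sub : forall n, set (set ('I_n -> A));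
  adm_subgroup : forall n X, (0 < n)%N -> @adm_sub n X -> is_subgroup X;
  adm_trivial : @adm_sub 1 [set 1];
  adm_full : @adm_sub 1 setT;
  adm_diagonal : @adm_sub 2 [set x : 'I_2 -> A | x ord0 = x ord_max];
  adm_proj : forall m n (s : 'I_n -> 'I_m), (0 < n)%N -> (n <= m)%N ->
    injective s -> forall X, @adm_sub m X ->
    @adm_sub n [set x \o s | x in X];
  adm_preproj : forall m n (s : 'I_n -> 'I_m), (0 < n)%N -> (n <= m)%N ->
    injective s -> forall Y, @adm_sub n Y ->
    @adm_sub m [set x : 'I_m -> A | Y (x \o s)];
  adm_setI : forall n X Y, (0 < n)%N ->
    @adm_sub n X -> @adm_sub n Y -> @adm_sub n (X `&` Y);
  adm_artinian : forall n (K : nat -> set ('I_n -> A)), (0 < n)%N ->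
    (forall k, @adm_sub n (K k)) -> (forall k, K k.+1 `<=` K k) ->
    exists N, forall k, (N <= k)%N -> K k = K N
}.

Section Admissible.
Variables (A : groupType) (H : artinian_structure A).

(* By adm_proj with m = n, the choice of the bijection f is irrelevant.
   For empty I, the unique subgroup of the trivial group A^I is admissible. *)
Definition admissible (I : finType) (X : set (I -> A)) : Prop :=
  if #|I| == 0%N then X = setT
  else exists2 f : 'I_#|I| -> I, bijective f & adm_sub H [set x \o f | x in X].

(* A^I x A^J is identified with A^(I + J). *)
Definition graph (I J : finType) (X : set (I -> A))
    (phi : (I -> A) -> (J -> A)) : set (I + J -> A) :=
  [set z : I + J -> A | X (z \o inl) /\ z \o inr = phi (z \o inl)].

(* phi is given as a total function; only its values on X matter. *)
Definition admissible_hom (I J : finType) (X : set (I -> A))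
    (Y : set (J -> A)) (phi : (I -> A) -> (J -> A)) : Prop :=
  [/\ admissible X, admissible Y, forall x, X x -> Y (phi x),
      forall x y, X x -> X y -> phi (x * y) = phi x * phi y
    & admissible (graph X phi)].
End Admissible.

Section Subshifts.
Variable G : monoidType.

Definition shift (A : Type) (g : G) (x : G -> A) : G -> A :=
  fun h => x (h * g).

Definition subshift (A : Type) (S : set (G -> A)) : Prop :=
  forall g x, S x -> S (shift g x).

Definition restr (A : Type) (E : {fset G}) (x : G -> A) : E -> A :=
  fun h => x (val h).
#[global] Arguments restr [A] E x h.

Definition restr_set (A : Type) (E : {fset G}) (S : set (G -> A)) :
    set (E -> A) := restr E @` S.
#[global] Arguments restr_set [A] E S _.

Definition sft_of (A : Type) (D : {fset G}) (P : set (D -> A)) :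
    set (G -> A) := [set x | forall g, P (restr D (shift g x))].

Definition is_sft (A : Type) (S : set (G -> A)) : Prop :=
  exists (D : {fset G}) (P : set (D -> A)), S = sft_of P.

(* Maps S -> B^G and S_M -> B are given as total functions, constrained only on
   S and on S_M; this loses nothing when B is nonempty. *)
Definition local_map (A B : Type) (S : set (G -> A))
    (tau : (G -> A) -> (G -> B)) (M : {fset G}) (mu : (M -> A) -> B) : Prop :=
  forall x, S x -> forall g, tau x g = mu (restr M (shift g x)).

Definition cellular_automaton (A B : Type) (S : set (G -> A))
    (tau : (G -> A) -> (G -> B)) : Prop :=
  exists (M : {fset G}) (mu : (M -> A) -> B), local_map S tau mu.

Definition is_sofic (A : Type) (S : set (G -> A)) : Prop :=
  subshift S /\
  exists (C : Type) (T : set (G -> C)) (sigma : (G -> C) -> (G -> A)),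
    [/\ is_sft T, cellular_automaton T sigma & S = sigma @` T].

Definition prodiscrete_closed (A : choiceType) (S : set (G -> A)) : Prop :=
  closed (S : set {ptws G -> discrete_topology A}).

Variables (A : groupType) (H : artinian_structure A).

Definition admissible_group_subshift (S : set (G -> A)) : Prop :=
  subshift S /\ forall E : {fset G}, admissible H (restr_set E S).

(* The target A of the local map is A^1, that is 'I_1 -> A. *)
Definition admissible_group_ca (S : set (G -> A))
    (tau : (G -> A) -> (G -> A)) : Prop :=
  exists (M : {fset G}) (mu : (M -> A) -> A), local_map S tau mu /\
    admissible_hom H (restr_set M S) [set: 'I_1 -> A] (fun u => fun=> mu u).
End Subshifts.

(* Main.v *)
Require Import Defs.
From mathcomp Require Import all_boot finmap.
From mathcomp Require Import boolp classical_sets functions cardinality filter.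
From mathcomp Require Import topology_structure discrete_topology.
From mathcomp Require Import supremum_topology initial_topology.
From mathcomp Require Import function_spaces.

(** The point is that [tau] is reversible: its inverse [tau @` Sigma -> Sigma]
is again a cellular automaton. Granting this, both equivalences are formal.
Sofic subshifts are stable under cellular automata because these compose
([ca_comp], [sofic_image]), and [Delta] is the image of [tau @` Delta] under
the inverse. For finite type, extend [tau] and its inverse to cellular automata
[f] and [h] between the full shifts, by letting their local maps take
arbitrary values outside the original domain. Then [y] lies in [tau @` Delta]
exactly when [h y] lies in [Delta] and [f (h y) = y]. If [Delta] is of finite
type, both conditions bear on boundedly many coordinates of each translate of
[y], so [tau @` Delta] is of finite type too ([sft_image]); the roles of [tau]
and its inverse can be exchanged.

To invert [tau] one needs a finite [N] such that [tau x] on [N] determines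
[x 1]; shifting then recovers every [x g]. As [Sigma] is a group
([closed_group_subshift]) and [tau] a homomorphism ([group_caM]), it is enough
that [tau x = 1] on [N] forces [x 1 = 1] ([group_ca_finite_kernel]). Exhaust
[G] by finite sets [F n] and let [K n] be the group of the [x] in [Sigma] with
[tau x = 1] on [F n]. Over every finite window the restriction of [K n] is an
admissible subgroup ([admissible_local_kernel]), so by the Artinian condition
the restrictions of the decreasing sequence [K n] to a given window stabilize.
If no [F n] were suitable, some value [a <> 1] would occur at [1] in all the
[K n]. Stabilization replaces compactness here, in a Mittag-Leffler argument:
a partial configuration that extends to every [K n] can be prolonged window
after window, which produces a configuration [x] with [x 1 = a] that every
[K n] approximates on every finite window ([admissible_limit]). Since [Sigma]
is closed and [tau] is local, [x] is in [Sigma] and [tau x = 1], against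
injectivity. *)

Set Implicit Arguments.
Unset Strict Implicit.
Unset Printing Implicit Defensive.

Local Open Scope classical_set_scope.
Local Open Scope group_scope.

(** * Admissible subgroups of finite powers *)

Section AdmissibleSubgroups.
Variables (A : groupType) (H : artinian_structure A).

(** Two bijective indexings of [I] differ by a permutation, and projecting along
a permutation preserves admissibility. *)
Lemma admissible_frameP (I : finType) n (f : 'I_n -> I) (X : set (I -> A)) :
  (0 < n)%N -> bijective f ->
  admissible H X <-> adm_sub H [set x \o f | x in X].
Proof.
move=> n_gt0 f_bij; have nE : n = #|I| by rewrite -(bij_eq_card f_bij) card_ord.
subst n; rewrite /admissible -[_ == _]negbK -lt0n n_gt0 /=.
split=> [[f0 [f0' f0K f0'K] X0]|Xf]; last by exists f.
have s_inj : injective (f0' \o f).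
  exact: inj_comp (can_inj f0'K) (bij_inj f_bij).
suff -> : [set x \o f | x in X] =
    [set z \o (f0' \o f) | z in [set x \o f0 | x in X]] by exact: adm_proj.
rewrite image_comp; apply: eq_imagel => x _; apply/funext => i /=.
by rewrite f0'K.
Qed.

Lemma admissible0 (I : finType) (X : set (I -> A)) :
  #|I| = 0%N -> admissible H X <-> X = setT.
Proof. by move=> I0; rewrite /admissible I0. Qed.

Lemma admissible_ord n (X : set ('I_n.+1 -> A)) :
  adm_sub H X -> admissible H X.
Proof.
move=> HX; apply/(@admissible_frameP _ _ id) => //; first by exists id.
by rewrite image_id.
Qed.

Lemma admissible_enumP (I : finType) (X : set (I -> A)) : (0 < #|I|)%N ->
  admissible H X <-> adm_sub H [set x \o (enum_val : 'I_#|I| -> I) | x in X].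
Proof. by move=> /admissible_frameP; apply; apply: enum_val_bij. Qed.

Lemma comp_enum_val_inj (I : finType) :
  injective (fun x : I -> A => x \o (enum_val : 'I_#|I| -> I)).
Proof.
move=> x y xy; apply/funext => i; rewrite -(enum_rankK i).
by move/(congr1 (@^~ (enum_rank i))): xy.
Qed.

Lemma admissible_subgroup (I : finType) (X : set (I -> A)) :
  admissible H X -> is_subgroup X.
Proof.
have [I0 /admissible0-> //|I_gt0] := posnP #|I|.
move=> /(admissible_enumP _ I_gt0)/(adm_subgroup I_gt0)[X1 XM XV].
split=> [|x y|x]; rewrite -!(image_inj (@comp_enum_val_inj I)) //.
  exact: XM.
exact: XV.
Qed.

Lemma admissible_proj (I J : finType) (s : J -> I) (X : set (I -> A)) :
  injective s -> admissible H X -> admissible H [set x \o s | x in X].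
Proof.
move=> s_inj HX; have [J0|J_gt0] := posnP #|J|.
  apply/admissible0 => //; apply/seteqP; split=> // y _.
  have [X1 _ _] := admissible_subgroup HX; exists 1 => //.
  by apply/funext => j; have := fintype0 j J0.
have leJI : (#|J| <= #|I|)%N by apply: leq_card s_inj.
have I_gt0 := leq_trans J_gt0 leJI.
apply/(admissible_enumP _ J_gt0).
pose s' (k : 'I_#|J|) : 'I_#|I| := enum_rank (s (enum_val k)).
have s'_inj : injective s'.
  by move=> k l /enum_rank_inj/s_inj/enum_val_inj.
suff -> : [set x \o enum_val | x in [set x \o s | x in X]] =
    [set z \o s' | z in [set x \o (enum_val : 'I_#|I| -> I) | x in X]].
  by apply: adm_proj => //; apply/(admissible_enumP _ I_gt0).
rewrite !image_comp; apply: eq_imagel => x _; apply/funext => k /=.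
by rewrite /s' enum_rankK.
Qed.

(** The case of an empty [J] has to wait: there the preimage is the full power,
whose admissibility is itself obtained as a preimage of [A^1]. *)
Let admissible_preim0 (I J : finType) (s : J -> I) (Y : set (J -> A)) :
  (0 < #|J|)%N -> injective s -> admissible H Y ->
  admissible H [set x : I -> A | Y (x \o s)].
Proof.
move=> J_gt0 s_inj HY; have leJI : (#|J| <= #|I|)%N by apply: leq_card s_inj.
have I_gt0 := leq_trans J_gt0 leJI.
apply/(admissible_enumP _ I_gt0).
pose s' (k : 'I_#|J|) : 'I_#|I| := enum_rank (s (enum_val k)).
have s'_inj : injective s'.
  by move=> k l /enum_rank_inj/s_inj/enum_val_inj.
move/(admissible_enumP _ J_gt0) : HY => /(adm_preproj J_gt0 leJI s'_inj).
congr (adm_sub H _); apply/seteqP; split=> [z [y Yy yz]|_ [x Yx <-]] /=.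
  exists (z \o enum_rank); last by apply/funext => k /=; rewrite enum_valK.
  suff -> : (z \o enum_rank) \o s = y by [].
  apply/funext => j; move/(congr1 (@^~ (enum_rank j))): yz.
  by rewrite /= /s' enum_rankK.
exists (x \o s) => //; apply/funext => k /=.
by rewrite /s' enum_rankK.
Qed.

Lemma admissibleT (I : finType) : admissible H [set: I -> A].
Proof.
have [I0|/card_gt0P[i _]] := posnP #|I|; first exact/admissible0.
apply: (@admissible_preim0 _ _ (fun _ : 'I_1 => i) setT).
- by rewrite card_ord.
- by move=> k l _; rewrite !ord1.
- exact/admissible_ord/adm_full.
Qed.

Lemma admissible_preim_inj (I J : finType) (s : J -> I) (Y : set (J -> A)) :
  injective s -> admissible H Y -> admissible H [set x : I -> A | Y (x \o s)].
Proof.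
have [J0 _|] := posnP #|J|; last exact: admissible_preim0.
by move=> /(admissible0 _ J0)->; apply: admissibleT.
Qed.

Lemma admissibleI (I : finType) (X Y : set (I -> A)) :
  admissible H X -> admissible H Y -> admissible H (X `&` Y).
Proof.
have [I0|I_gt0] := posnP #|I|.
  move=> /(admissible0 _ I0)-> /(admissible0 _ I0)->.
  by apply/admissible0; rewrite ?setTI.
move=> /(admissible_enumP _ I_gt0) HX /(admissible_enumP _ I_gt0) HY.
apply/(admissible_enumP _ I_gt0).
have := adm_setI I_gt0 HX HY; congr (adm_sub H _).
apply/seteqP; split=> [_ [[x Xx <-] [y Yy /comp_enum_val_inj xy]]|_ [x [Xx Yx] <-]].
  by exists x => //; split=> //; rewrite -xy.
by split; exists x.
Qed.

Lemma admissible_bigI (I : finType) (T : eqType) (s : seq T)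
    (X : T -> set (I -> A)) :
  (forall t, admissible H (X t)) ->
  admissible H [set x | forall t, t \in s -> X t x].
Proof.
move=> HX; elim: s => [|t s IHs].
  by rewrite (_ : [set _ | _] = setT); [exact: admissibleT | exact/seteqP].
have := admissibleI (HX t) IHs; congr (admissible H _).
apply/seteqP; split=> x /=.
  by case=> Xt Xs u; rewrite inE => /predU1P[->|/Xs].
by move=> Xx; split=> [|u us]; apply: Xx; rewrite inE ?eqxx ?us ?orbT.
Qed.

Lemma admissible_forall (I T : finType) (X : T -> set (I -> A)) :
  (forall t, admissible H (X t)) -> admissible H [set x | forall t, X t x].
Proof.
move=> /(admissible_bigI (enum T)); congr (admissible H _).
by apply/seteqP; split=> x /= Xx t *; apply: Xx; rewrite mem_enum.
Qed.

Lemma admissible_diag (I : finType) (i j : I) :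
  admissible H [set x : I -> A | x i = x j].
Proof.
have [->|ij] := eqVneq i j.
  by rewrite (_ : [set _ | _] = setT); [exact: admissibleT | exact/seteqP].
have t_inj : injective (tnth [tuple i; j]).
  by apply/tuple_uniqP; rewrite /= inE ij.
exact: (admissible_preim_inj t_inj (admissible_ord (adm_diagonal H))).
Qed.

Lemma admissible_eq1 (I : finType) (i : I) :
  admissible H [set x : I -> A | x i = 1].
Proof.
have s_inj : injective (fun _ : 'I_1 => i) by move=> k l _; rewrite !ord1.
have := admissible_preim_inj s_inj (admissible_ord (adm_trivial H)).
congr (admissible H _); apply/seteqP; split=> x /= [].
  by move/(congr1 (@^~ ord0)).
by move=> xi; apply/funext => k /=.
Qed.

(** In a monoid, translation [h |-> h * g] may identify distinct elements of a
window, so preimages along arbitrary maps [s] are needed, whereas the axioms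
speak of injections only. The non-injective case is a quantifier elimination:
add a copy [w \o inr] of the coordinates in [J], force it to equal
[w \o inl \o s] by diagonal conditions, then project the copy away. *)
Lemma admissible_preim (I J : finType) (s : J -> I) (Y : set (J -> A)) :
  admissible H Y -> admissible H [set x : I -> A | Y (x \o s)].
Proof.
move=> HY.
have HZ : admissible H
    [set w : I + J -> A | forall j, w (inl (s j)) = w (inr j)].
  by apply: admissible_forall => j; apply: admissible_diag.
have := admissibleI HZ (admissible_preim_inj (@inr_inj I J) HY).
move/(admissible_proj (@inl_inj I J)); congr (admissible H _).
apply/seteqP; split=> [_ [w [ws Yw] <-]|x Yx] /=.
  by rewrite (_ : _ \o s = w \o inr)//; apply/funext => j /=.
by exists (fun k => match k with inl i => x i | inr j => x (s j) end).
Qed.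

(** Cut the graph by the condition that the value is trivial, then project onto
the source. *)
Lemma admissible_ker (I J : finType) (X : set (I -> A)) (Y : set (J -> A))
    (phi : (I -> A) -> (J -> A)) :
  admissible_hom H X Y phi -> admissible H [set x | X x /\ phi x = 1].
Proof.
case=> _ _ _ _ Hphi.
have HZ : admissible H [set w : I + J -> A | forall j, w (inr j) = 1].
  by apply: admissible_forall => j; apply: admissible_eq1.
have := admissible_proj (@inl_inj I J) (admissibleI Hphi HZ).
congr (admissible H _); apply/seteqP; split=> [_ [w [[Xw wE] w1] <-]|x [Xx x1]].
  by split=> //; rewrite -wE; apply/funext => j /=.
by exists (fun k => match k with inl i => x i | inr j => 1 end) => //; split=> //;
  split=> //=; rewrite /= [RHS]x1.
Qed.

Lemma admissible_artinian (I : finType) (K : nat -> set (I -> A)) :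
  (forall n, admissible H (K n)) -> (forall n, K n.+1 `<=` K n) ->
  exists N, forall n, (N <= n)%N -> K n = K N.
Proof.
move=> HK leK; have [I0|I_gt0] := posnP #|I|.
  have KT n : K n = setT by apply/admissible0.
  by exists 0%N => n _; rewrite !KT.
have HKe n := (admissible_enumP (K n) I_gt0).1 (HK n).
have [n|N NP] := adm_artinian I_gt0 HKe; first exact/image_subset/leK.
exists N => n /NP KnN; apply/funext => x.
by rewrite -!(image_inj (@comp_enum_val_inj I) (a := x)) KnN.
Qed.

End AdmissibleSubgroups.

(** * Finite windows and the prodiscrete topology *)

Section Configurations.
Variable G : monoidType.
Implicit Types (E F M N : {fset G}) (g h : G).

(** The window that a cellular automaton with memory [E] reads in order to
produce its output on [F]. *)
Definition mulfs E F : {fset G} := [fset g * h | g in E, h in F]%fset.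

Lemma mem_mulfs E F g h : g \in E -> h \in F -> g * h \in mulfs E F.
Proof. by move=> gE hF; apply/imfset2P; exists g => //; exists h. Qed.

Definition mulfs_sub E F (g : E) (h : F) : mulfs E F :=
  [` mem_mulfs (valP g) (valP h)]%fset.

Lemma shiftM (A : Type) g h (x : G -> A) : shift g (shift h x) = shift (g * h) x.
Proof. by apply/funext => k; rewrite /shift mulgA. Qed.

Lemma eq_restrP (A : Type) E (x y : G -> A) :
  restr E x = restr E y <-> {in E, x =1 y}.
Proof.
split=> [xy g gE|xy]; last by apply/funext => g; apply: xy; apply: valP.
exact: (congr1 (@^~ [` gE]%fset) xy).
Qed.

Lemma restr_setP (A : Type) E (S : set (G -> A)) (x : G -> A) :
  restr_set E S (restr E x) <-> exists2 y, S y & {in E, y =1 x}.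
Proof. by split=> -[y Sy /eq_restrP]; exists y. Qed.

(** The members of [S] that agree with [x] on a finite window form, as the
window grows, a filter base converging pointwise to [x]. *)
Lemma prodiscrete_closed_approx (A : choiceType) (S : set (G -> A)) x :
  prodiscrete_closed S -> (forall E, exists2 y, S y & {in E, y =1 x}) -> S x.
Proof.
move=> Scl xS; pose B E := [set y | S y /\ {in E, y =1 x}].
have FB : ProperFilter (filter_from setT B).
  apply: filter_from_proper => [|E _]; last by have [y] := xS E; exists y.
  apply: filter_fromT_filter; first by exists fset0.
  move=> E F; exists (E `|` F)%fset => y [Sy yx].
  by split; split=> // g gE; apply: yx; rewrite inE gE ?orbT.
apply: (@closed_cvg _ {ptws G -> discrete_topology A} _ FB id S Scl).
  by exists fset0 => // y [].
apply/cvg_sup => g; apply/cvg_image.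
  by apply/seteqP; split=> // a _; exists (fun=> a).
move=> U /principal_filterP Ux; exists [set y | U (y g)].
  by exists [fset g]%fset => // y [_ yx]; rewrite /= yx ?inE.
by apply/seteqP; split=> [_ [y Uy <-]//|a Ua]; exists (fun=> a).
Qed.

End Configurations.

(** * Cellular automata, finite type and sofic subshifts *)

Section CellularAutomata.
Variable G : monoidType.
Implicit Types (E F M N : {fset G}) (g h : G).

Definition ca_map (A B : Type) M (mu : (M -> A) -> B) (x : G -> A) : G -> B :=
  fun g => mu (restr M (shift g x)).

Lemma ca_map_shift (A B : Type) M (mu : (M -> A) -> B) g x :
  ca_map mu (shift g x) = shift g (ca_map mu x).
Proof. by apply/funext => h; rewrite /ca_map shiftM. Qed.

Lemma ca_map_local (A B : Type) M (mu : (M -> A) -> B) E x y :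
  {in mulfs M E, x =1 y} -> {in E, ca_map mu x =1 ca_map mu y}.
Proof.
move=> xy g gE; congr mu; apply/eq_restrP => h hM.
by apply: xy; apply: mem_mulfs.
Qed.

Lemma local_mapE (A B : Type) (S : set (G -> A)) tau M (mu : (M -> A) -> B) x :
  local_map S tau mu -> S x -> tau x = ca_map mu x.
Proof. by move=> tauE Sx; apply/funext => g; apply: tauE. Qed.

Lemma ca_shift (A B : Type) (S : set (G -> A)) (tau : (G -> A) -> G -> B) :
  subshift S -> cellular_automaton S tau ->
  forall g x, S x -> tau (shift g x) = shift g (tau x).
Proof.
move=> Ssub [M [mu tauE]] g x Sx.
by rewrite !(local_mapE tauE)// ?ca_map_shift//; apply: Ssub.
Qed.

Lemma image_subshift (A B : Type) (S : set (G -> A)) (tau : (G -> A) -> G -> B) :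
  subshift S -> cellular_automaton S tau -> subshift (tau @` S).
Proof.
move=> Ssub tau_ca g _ [x Sx <-]; rewrite -(ca_shift Ssub)//.
by exists (shift g x) => //; apply: Ssub.
Qed.

Lemma sub_ca (A B : Type) (S S' : set (G -> A)) (tau : (G -> A) -> G -> B) :
  S' `<=` S -> cellular_automaton S tau -> cellular_automaton S' tau.
Proof. by move=> S'S [M [mu tauE]]; exists M, mu => x /S'S; apply: tauE. Qed.

Lemma ca_comp (A B C : Type) (S : set (G -> A)) (sigma : (G -> A) -> G -> B)
    (tau : (G -> B) -> G -> C) :
  cellular_automaton S sigma -> cellular_automaton (sigma @` S) tau ->
  cellular_automaton S (tau \o sigma).
Proof.
move=> [N [nu sigmaE]] [M [mu tauE]].
exists (mulfs N M), (fun u => mu (fun m => nu (fun n => u (mulfs_sub n m)))).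
move=> x Sx g /=; rewrite tauE; last by exists x.
congr mu; apply/funext => m; rewrite /restr /shift sigmaE//; congr nu.
by apply/funext => n; rewrite /restr /shift /= mulgA.
Qed.

(** Lets a finite type condition be stated on whole configurations instead of
patterns over a window. *)
Lemma local_is_sft (A : Type) E (Q : set (G -> A)) :
  (forall x y, {in E, x =1 y} -> Q x -> Q y) ->
  is_sft [set x | forall g, Q (shift g x)].
Proof.
move=> Qloc; exists E, (restr E @` Q); apply/seteqP.
split=> x /= xQ g; first by exists (shift g x).
by have [y Qy /eq_restrP yx] := xQ g; apply: Qloc Qy.
Qed.

(** The extensions [f] and [h] of [tau] and [sigma] to the full shifts need not
be inverse to each other, whence the extra local condition [f (h y) = y]: it
forces [y] to be the image of [h y]. *)
Lemma sft_image (A B : Type) (S : set (G -> A)) (tau : (G -> A) -> G -> B)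
    (sigma : (G -> B) -> G -> A) :
  cellular_automaton S tau -> cellular_automaton (tau @` S) sigma ->
  (forall x, S x -> sigma (tau x) = x) -> is_sft S -> is_sft (tau @` S).
Proof.
move=> [M [mu tauE]] [N [nu sigmaE]] tauK [D [P SE]].
pose f := ca_map mu; pose h := ca_map nu.
have fE x : S x -> tau x = f x by apply: local_mapE.
have hK x : S x -> h (f x) = x.
  by move=> Sx; rewrite -fE// -[RHS]tauK// (local_mapE sigmaE)//; exists x.
pose Q y := P (restr D (h y)) /\ f (h y) 1 = y 1.
have -> : tau @` S = [set y | forall g, Q (shift g y)].
  apply/seteqP; split=> [_ [x Sx <-] g|y yQ].
    rewrite fE//; split; last by rewrite /h /f !ca_map_shift -/f -/h hK.
    by rewrite /h ca_map_shift -/h hK//; move: Sx; rewrite SE; apply.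
  have Sh : S (h y).
    by rewrite SE => g; have [+ _] := yQ g; rewrite /h ca_map_shift.
  exists (h y) => //; rewrite fE//; apply/funext => g; have [_] := yQ g.
  by rewrite /f /h !ca_map_shift /shift mul1g.
(* Reading [y 1] takes the window [1], the pattern of [h y] over [D] takes
   [N D], and [f (h y) 1] takes [N M]. *)
apply: (@local_is_sft _ (1%g |` (mulfs N D `|` mulfs N (mulfs M [fset 1%g])))%fset).
move=> y z yz [Py y1]; split.
  rewrite (_ : restr D (h z) = restr D (h y))//; apply/eq_restrP.
  by apply: ca_map_local => g gD; rewrite yz// !inE gD orbT.
rewrite -yz -?y1; last by rewrite !inE eqxx.
have : {in [fset 1%g]%fset, f (h z) =1 f (h y)}.
  apply/ca_map_local/ca_map_local => g gD.
  by rewrite yz// !inE gD !orbT.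
by apply; rewrite inE.
Qed.

Lemma sofic_image (A B : Type) (S : set (G -> A)) (tau : (G -> A) -> G -> B) :
  cellular_automaton S tau -> is_sofic S -> is_sofic (tau @` S).
Proof.
move=> tau_ca [Ssub [C [T [sigma [Tsft sigma_ca SE]]]]].
split; first exact: image_subshift.
exists C, T, (tau \o sigma); split=> //; last by rewrite SE image_comp.
by apply: ca_comp => //; rewrite -SE.
Qed.

End CellularAutomata.

(** * Reversibility of injective admissible group cellular automata *)

Lemma descending_le (T : Type) (K : nat -> set T) :
  (forall n, K n.+1 `<=` K n) -> forall m n, (m <= n)%N -> K n `<=` K m.
Proof.
by move=> decK m n /subnK <-; elim: (n - m)%N => [x //|k IHk x /decK/IHk].
Qed.

Section Reversibility.
Variables (G : monoidType) (A : groupType) (H : artinian_structure A).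
Hypothesis countG : countable [set: G].
Implicit Types (E F M N : {fset G}) (g h : G).

Lemma exhaustion F0 : exists F : nat -> {fset G},
  [/\ F 0%N = F0, forall k, {subset F k <= F k.+1} &
      forall E, exists k, {subset E <= F k}].
Proof.
have /countable_injP[c c_injT] := countG.
have c_inj : injective c by move=> g h; apply: c_injT; rewrite inE.
pose e k := xget (1 : G) [set g | c g = k].
have ec g : e (c g) = g.
  by apply: c_inj; rewrite /e; case: xgetP => [h _ //|/(_ g)/(_ erefl)].
pose F k := (F0 `|` [fset e i | i in iota 0 k])%fset.
exists F; split=> [|k g|E].
- by apply/fsetP => g; rewrite inE orbC; case: imfsetP => // -[].
- rewrite !inE => /orP[->//|/imfsetP[i /= ik ->]]; apply/orP; right.
  apply/imfsetP; exists i => //; move: ik.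
  by rewrite (mem_iota 0 k) (mem_iota 0 k.+1) => /ltnW.
exists (\max_(g <- E) (c g).+1) => g gE; rewrite inE; apply/orP; right.
apply/imfsetP; exists (c g) => //; rewrite /= mem_iota add0n.
by rewrite (leq_bigmax_seq _ gE).
Qed.

(** A Mittag-Leffler argument. The configurations approximated by every [K n] on
[F'] are those approximated by [K N] for a large [N], so a partial
configuration over [F] that extends to all the [K n] can be prolonged to [F'];
doing this along an exhaustion of [G] defines the limit. *)
Lemma admissible_limit (K : nat -> set (G -> A)) F0 (x0 : G -> A) :
  (forall n F, admissible H (restr_set F (K n))) ->
  (forall n, K n.+1 `<=` K n) ->
  (forall n, exists2 y, K n y & {in F0, y =1 x0}) ->
  exists x, {in F0, x =1 x0} /\
    forall F n, exists2 y, K n y & {in F, y =1 x}.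
Proof.
move=> HK decK x0K.
have leK := descending_le decK.
pose L F x := forall n, exists2 y, K n y & {in F, y =1 x}.
have extend F F' x : {subset F <= F'} -> L F x ->
    exists x', L F' x' /\ {in F, x' =1 x}.
  move=> FF' Lx.
  have [n|N stab] := admissible_artinian (fun n => HK n F').
    exact/image_subset/decK.
  have [y Ky yx] := Lx N; exists y; split=> // n.
  have [/leK KNn|/ltnW/stab KnN] := leqP n N; first by exists y => //; apply: KNn.
  by apply/restr_setP; rewrite KnN; exists y.
have [F [F00 Fsub Fall]] := exhaustion F0.
have /choice[nxt nxtP] (p : nat * (G -> A)) : exists x',
    L (F p.1) p.2 -> L (F p.1.+1) x' /\ {in F p.1, x' =1 p.2}.
  have [/(extend _ _ _ (Fsub p.1))[x' x'P]|nL] := pselect (L (F p.1) p.2).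
    by exists x'.
  by exists p.2 => /nL.
pose x_ := fix x_ k := if k is k'.+1 then nxt (k', x_ k') else x0.
have Lx_ k : L (F k) (x_ k).
  by elim: k => [|k /(nxtP (k, _))[]//]; rewrite F00.
have x_S k : {in F k, x_ k.+1 =1 x_ k} by have [] := nxtP (k, x_ k) (Lx_ k).
have Fle k l : (k <= l)%N -> {subset F k <= F l}.
  by move=> /subnK <-; elim: (l - k)%N => // j IHj g /IHj/Fsub.
have x_le k l : (k <= l)%N -> {in F k, x_ l =1 x_ k}.
  move=> /subnK <-; elim: (l - k)%N => // j IHj g gk.
  by rewrite addSn x_S ?IHj//; apply: Fle gk; rewrite leq_addl.
have /choice[c cF] g : exists k, g \in F k.
  by have [k kP] := Fall [fset g]%fset; exists k; apply: kP; rewrite inE.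
(* The value at [g] never changes once [g] has entered the exhaustion. *)
pose x g := x_ (c g) g.
have xE k : {in F k, x =1 x_ k}.
  move=> g gk; rewrite /x; have [/x_le|/ltnW/x_le] := leqP k (c g); first exact.
  by move=> ->.
exists x; split=> [g gF0|E n]; first by rewrite (xE 0%N) ?F00.
have [k Ek] := Fall E; have [y Ky yx] := Lx_ k n.
by exists y => // g /Ek gk; rewrite yx// (xE k).
Qed.

Variables (Sigma : set (G -> A)) (tau : (G -> A) -> G -> A).
Hypotheses (Sigma_closed : prodiscrete_closed Sigma)
  (Sigma_adm : admissible_group_subshift H Sigma).

Let Sigma_sub : subshift Sigma. Proof. by case: Sigma_adm. Qed.

(** Admissibility makes each finite restriction a group; being closed, [Sigma]
is determined by these restrictions. *)
Lemma closed_group_subshift : is_subgroup Sigma.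
Proof.
have HS E := admissible_subgroup (Sigma_adm.2 E).
split=> [|x y Sx Sy|x Sx]; apply: prodiscrete_closed_approx => // E;
  apply/restr_setP; have [S1 SM SV] := HS E.
- exact: S1.
- by apply: (SM (restr E x) (restr E y)); [exists x | exists y].
- by apply: (SV (restr E x)); exists x.
Qed.

Lemma group_ca_ca : admissible_group_ca H Sigma tau ->
  cellular_automaton Sigma tau.
Proof. by move=> [M [mu [tauE _]]]; exists M, mu. Qed.

Lemma group_caM : admissible_group_ca H Sigma tau ->
  forall x y, Sigma x -> Sigma y -> tau (x * y) = tau x * tau y.
Proof.
move=> [M [mu [tauE [_ _ _ muM _]]]] x y Sx Sy.
have [_ SM _] := closed_group_subshift.
apply/funext => g; rewrite {2}/mul/= !tauE//; last exact: SM.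
have SMr z : Sigma z -> restr_set M Sigma (restr M (shift g z)).
  by move=> Sz; exists (shift g z) => //; apply: Sigma_sub.
exact: (congr1 (@^~ ord0) (muM _ _ (SMr _ Sx) (SMr _ Sy))).
Qed.

(** On a window [F'] that contains both [F] and all that [tau] reads to compute
its values on [E], the condition [tau x = 1] on [E] is a finite conjunction of
translates of the kernel of the local map; the restriction to [F] is then a
projection. *)
Lemma admissible_local_kernel E F : admissible_group_ca H Sigma tau ->
  admissible H (restr_set F [set x | Sigma x /\ {in E, tau x =1 1}]).
Proof.
move=> [M [mu [tauE /admissible_ker Hker]]].
pose F' := (F `|` mulfs M E)%fset.
have sub1 (g : F) : val g \in F' by rewrite inE (valP g).
have sub2 (g : mulfs M E) : val g \in F' by rewrite inE (valP g) orbT.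
pose i1 (g : F) : F' := [` sub1 g]%fset.
pose i2 (g : E) (h : M) : F' := [` sub2 (mulfs_sub h g)]%fset.
have i1_inj : injective i1 by move=> g h /(congr1 val) /= /val_inj.
have HK : admissible H (restr_set F' Sigma `&`
    [set u : F' -> A | forall g : E,
       [set v | restr_set M Sigma v /\ (fun=> mu v) = 1 :> ('I_1 -> A)]
         (u \o i2 g)]).
  apply: admissibleI; first exact: Sigma_adm.2.
  by apply: admissible_forall => g; apply: admissible_preim Hker.
have := admissible_proj i1_inj HK; congr (admissible H _).
apply/seteqP; split=> [_ [_ [[x Sx <-] xK] <-]|_ [x [Sx xE] <-]].
  exists x => //; split=> // g gE; rewrite tauE//.
  by have [_ /(congr1 (@^~ ord0))] := xK [` gE]%fset.
exists (restr F' x) => //; split=> [|g]; first by exists x.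
split; first by exists (shift (val g) x) => //; apply: Sigma_sub.
have xg : tau x (val g) = 1 := xE _ (valP g).
by apply/funext => k; rewrite [RHS](_ : _ = 1)// -xg tauE.
Qed.

(** The finite form of injectivity. The Artinian condition at the window [1]
gives [n] such that every value at [1] taken in [K n] is taken in all later
[K m]; a nontrivial one would propagate to a nontrivial element of the kernel
of [tau]. *)
Lemma group_ca_finite_kernel : admissible_group_ca H Sigma tau ->
  {in Sigma &, injective tau} ->
  exists N, forall x, Sigma x -> {in N, tau x =1 1} -> x 1 = 1.
Proof.
move=> tauG tau_inj; have [S1 _ _] := closed_group_subshift.
have [F [_ Fsub Fall]] := exhaustion fset0.
pose K n := [set x | Sigma x /\ {in F n, tau x =1 1}].
have HK n E : admissible H (restr_set E (K n)) by apply: admissible_local_kernel.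
have decK n : K n.+1 `<=` K n.
  by move=> x [Sx x1]; split=> // g /Fsub; apply: x1.
have leK := descending_le decK.
have [n|n stab] := admissible_artinian (fun n => HK n [fset 1%g]%fset).
  exact/image_subset/decK.
exists (F n) => y Sy y1.
have [x [xy xK]] : exists x, {in [fset 1%g]%fset, x =1 y} /\
    forall E m, exists2 z, K m z & {in E, z =1 x}.
  apply: admissible_limit HK decK _ => m; apply/restr_setP.
  have [/leK Knm|/ltnW/stab->] := leqP m n; last by exists y.
  by exists y => //; apply: Knm.
have Sx : Sigma x.
  apply: prodiscrete_closed_approx => // E.
  by have [z [Sz _] zx] := xK E 0%N; exists z.
have tau1 : tau 1 = 1.
  by apply: (@mulgI _ (tau 1)); rewrite -(group_caM tauG)// !mulg1.
have taux : tau x = 1.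
  have [M [mu tauE]] := group_ca_ca tauG.
  apply/funext => g; have [m gm] := Fall [fset g]%fset.
  have [z [Sz z1] zx] := xK (mulfs M [fset g]%fset) m.
  have gg : g \in [fset g]%fset by rewrite inE.
  rewrite (local_mapE tauE)// -(ca_map_local mu zx gg) -(local_mapE tauE)//.
  exact/z1/gm.
have x1 : x = 1 by apply: tau_inj; rewrite ?inE// taux.
by rewrite -xy ?inE// x1.
Qed.

Lemma injective_group_ca_reversible : admissible_group_ca H Sigma tau ->
  {in Sigma &, injective tau} ->
  exists2 sigma : (G -> A) -> G -> A, cellular_automaton (tau @` Sigma) sigma &
    forall x, Sigma x -> sigma (tau x) = x.
Proof.
move=> tauG tau_inj; have [N NP] := group_ca_finite_kernel tauG tau_inj.
have [S1 SM SV] := closed_group_subshift.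
have determined x y : Sigma x -> Sigma y -> {in N, tau x =1 tau y} -> x 1 = y 1.
  move=> Sx Sy xy; have Sz := SM _ _ Sx (SV _ Sy).
  have zyE : x * y^-1 * y = x by rewrite -mulgA mulVg mulg1.
  rewrite -zyE [LHS](_ : _ = (x * y^-1) 1 * y 1)// NP ?mul1g// => g gN.
  apply: (@mulIg _ (tau y g)); rewrite mul1g -[RHS]xy//.
  by rewrite -[in RHS]zyE (group_caM tauG Sz Sy).
(* By [determined], every [x] in [Sigma] whose image restricts to [v] has the
   same value at the identity of [G], so the choice is harmless. *)
pose nu (v : N -> A) := xget 1 [set x | Sigma x /\ restr N (tau x) = v] 1.
have tau_sh := ca_shift Sigma_sub (group_ca_ca tauG).
have nuP x g : Sigma x -> nu (restr N (shift g (tau x))) = x g.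
  move=> Sx; rewrite -tau_sh// /nu; have Sgx := Sigma_sub g Sx.
  case: xgetP => [_ -> [Sy /eq_restrP]|/(_ (shift g x))/not_andP[]//].
  by move=> /determined->//; rewrite /shift mul1g.
exists (ca_map nu); last by move=> x Sx; apply/funext => g; apply: nuP.
by exists N, nu.
Qed.

End Reversibility.

Theorem theorem8p4 (G : monoidType) (countG : countable [set: G])
    (A : groupType) (H : artinian_structure A)
    (Sigma : set (G -> A)) (Sigma_closed : prodiscrete_closed Sigma)
    (Sigma_adm : admissible_group_subshift H Sigma)
    (Delta : set (G -> A)) (Delta_subshift : subshift Delta)
    (Delta_sub : Delta `<=` Sigma)
    (tau : (G -> A) -> (G -> A)) (tau_ca : admissible_group_ca H Sigma tau)
    (tau_inj : {in Sigma &, injective tau}) :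
  (is_sft Delta <-> is_sft (tau @` Delta)) /\
  (is_sofic Delta <-> is_sofic (tau @` Delta)).
Proof.
have [sigma sigma_ca tauK] :=
  injective_group_ca_reversible countG Sigma_closed Sigma_adm tau_ca tau_inj.
have tauD := sub_ca Delta_sub (group_ca_ca tau_ca).
have sigmaD := sub_ca (image_subset tau Delta_sub) sigma_ca.
have DK x : Delta x -> sigma (tau x) = x by move=> /Delta_sub/tauK.
have DE : sigma @` (tau @` Delta) = Delta.
  by rewrite image_comp -[RHS]image_id; apply: eq_imagel => x /DK.
split; split; [exact: sft_image DK | | exact: sofic_image tauD |].
- rewrite -[in X in _ -> X]DE; apply: (sft_image (sigma := tau) sigmaD).
    by rewrite DE.
  by move=> _ [x Dx <-]; rewrite DK.
- by move=> /(sofic_image sigmaD); rewrite DE.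
Qed.
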